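(* Let $(R,\mathfrak{m})$ be a local ring of prime characteristic $p>0$ and dimension $d>0$, let $M$ be a finitely generated $R$-module, and let $s>0$ be a real number. Let $I_1,I_2$ be $\mathfrak{m}$-primary ideals of $R$, and let $J_1=I_1\ltimes I_1M$ and $J_2=I_2\ltimes I_2M$, ideals of the idealization $R\ltimes M$. Then $$h_s(J_1,J_2;R\ltimes M)=h_s(I_1,I_2;R)+h_s(I_1,I_2;M)=\lim_{e\to\infty}\frac{\ell_R\Big((R\ltimes M)\big/\big((I_1^{\lceil sp^e\rceil}+I_2^{[p^e]})\ltimes(I_1^{\lceil sp^e\rceil}+I_2^{[p^e]})M\big)\Big)}{p^{ed}},$$ where the first $h$-function is taken over the ring $R\ltimes M$ and the other two over $R$.
   Context: All rings are commutative, Noetherian, local, with identity. Idealization: for a ring $R$ and an $R$-module $M$, $R\ltimes M$ is the set of pairs $(r,m)$, $r\in R$, $m\in M$, with componentwise addition and multiplication $(r,m)(r',m')=(rr',rm'+r'm)$. If $(R,\mathfrak{m})$ is local and $M$ is finitely generated, then $R\ltimes M$ is local with maximal ideal $\mathfrak{m}\ltimes M$, has the same characteristic as $R$, and $\dim(R\ltimes M)=\dim R$. For an ideal $I$ of $R$, $I\ltimes IM=\{(a,x):a\in I,\ x\in IM\}$, an ideal of $R\ltimes M$, which is $(\mathfrak{m}\ltimes M)$-primary if $I$ is $\mathfrak{m}$-primary. $R\ltimes M$ is an $R$-module via $r\mapsto(r,0)$. $h$-function: let $(A,\mathfrak{n})$ be a local ring of prime characteristic $p>0$ and dimension $d>0$,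 let $I,J$ be $\mathfrak{n}$-primary ideals, $N$ a finitely generated $A$-module, $s>0$ real. Put $$h_s(I,J;N)=\lim_{e\to\infty}\frac{\ell_A\big(N/(I^{\lceil sp^e\rceil}+J^{[p^e]})N\big)}{p^{ed}},\qquad d=\dim A,$$ where $\ell_A$ is length and $J^{[p^e]}$ is the ideal generated by the $p^e$-th powers of elements of $J$ (the limit is known to exist). *)

(* Defs.v *)
From HB Require Import structures.
From mathcomp Require Import all_boot all_order all_algebra.
From mathcomp Require Import generic_quotient ring_quotient.
From mathcomp Require Import all_classical all_reals all_analysis.

Set Implicit Arguments.
Unset Strict Implicit.
Unset Printing Implicit Defensive.

Import Order.TTheory GRing.Theory Num.Theory.
Import numFieldNormedType.Exports.

Local Open Scope classical_set_scope.
Local Open Scope quotient_scope.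
Local Open Scope ring_scope.

(* Submodules are MathComp's [submodClosed V]; an ideal of A is a submodule
   of the regular module A^o. *)
Notation ideal A := (submodClosed (GRing.regular A)).

Section Submodules.
Variables (A : comNzRingType) (V : lmodType A).
Implicit Types (U W : submodClosed V) (S : set V) (I : ideal A).

Definition full_pred of V := true.
Lemma full_pred_closed : subsemimod_closed full_pred.
Proof. by []. Qed.
HB.instance Definition _ := GRing.isSubSemiModClosed.Build A V full_pred full_pred_closed.
Definition fullS : submodClosed V := GRing.SubmodClosed.clone _ _ full_pred _.

(* The smallest submodule containing S. *)
Definition span_pred S (x : V) : bool :=
  `[< forall W, (forall y, S y -> y \in W) -> x \in W >].
Lemma span_pred_closed S : subsemimod_closed (span_pred S).
Proof.
split; first split.
- by apply/asboolP => W _; apply: rpred0.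
- move=> x y /asboolP hx /asboolP hy; apply/asboolP => W SW.
  by apply: rpredD; [apply: hx | apply: hy].
- move=> a x /asboolP hx; apply/asboolP => W SW.
  by apply: rpredZ; apply: hx.
Qed.
HB.instance Definition _ S :=
  GRing.isSubSemiModClosed.Build A V (span_pred S) (span_pred_closed S).
Definition spanS S : submodClosed V := GRing.SubmodClosed.clone _ _ (span_pred S) _.

Definition addS U W : submodClosed V :=
  spanS [set x | exists u w, [/\ u \in U, w \in W & x = u + w]].

Definition scaleS I U : submodClosed V :=
  spanS [set x | exists (a : A) (u : V), [/\ a \in I, u \in U & x = a *: u]].

Definition properS U W : Prop := {subset U <= W} /\ ~ {subset W <= U}.

Definition fgS U : Prop := exists s : seq V, U =i spanS [set` s].

Definition fg_module : Prop := fgS fullS.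

(* U viewed as a subgroup, so that Quotient.quot applies. *)
Definition zmod_pred U (x : V) : bool := x \in U.
Lemma zmod_pred_closed U : zmod_closed (zmod_pred U).
Proof.
split=> [|x y xU yU]; first exact: (rpred0 U).
by rewrite unfold_in /zmod_pred -scaleN1r rpredD // rpredZ.
Qed.
HB.instance Definition _ U :=
  GRing.isZmodClosed.Build V (zmod_pred U) (zmod_pred_closed U).

Definition zmodS U : zmodClosed V := GRing.ZmodClosed.clone _ (zmod_pred U) _.

Definition quotient_module U : Type := Quotient.quot (zmodS U).
HB.instance Definition _ U := GRing.Zmodule.on (quotient_module U).

Section QuotientModule.
Variable U : submodClosed V.
Local Notation Q := (Quotient.quot (zmodS U)).

Definition quot_scale (a : A) (x : quotient_module U) : quotient_module U :=
  \pi_Q (a *: repr (x : Q)).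

Lemma quot_scale_pi a (v : V) : quot_scale a (\pi_Q v) = \pi_Q (a *: v).
Proof.
apply/eqP; rewrite -Quotient.idealrBE unfold_in /zmod_pred -scalerBr rpredZ //.
have : (repr (\pi_Q v) == v %[mod Q])%qT by rewrite reprK.
by rewrite -Quotient.idealrBE.
Qed.

Fact quot_scalerA a b x :
  quot_scale a (quot_scale b x) = quot_scale (a * b) x.
Proof. by rewrite {1}[quot_scale b x]/quot_scale quot_scale_pi scalerA. Qed.

Fact quot_scale1r : left_id 1 quot_scale.
Proof. by move=> x; rewrite /quot_scale scale1r reprK. Qed.

Fact quot_scalerDr : right_distributive quot_scale +%R.
Proof.
move=> a x y; rewrite -[x](@reprK _ Q) -[y](@reprK _ Q) !quot_scale_pi.
have piD u v : (\pi_Q u : quotient_module U) + \pi_Q v = \pi_Q (u + v).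
  by rewrite [RHS](raddfD (\pi_Q)).
by rewrite !piD quot_scale_pi scalerDr.
Qed.

Fact quot_scalerDl x : {morph quot_scale^~ x : a b / a + b}.
Proof.
move=> a b; rewrite /quot_scale scalerDl.
by rewrite [LHS](raddfD (\pi_Q)).
Qed.

HB.instance Definition _ := GRing.Zmodule_isLmodule.Build A (quotient_module U)
  quot_scalerA quot_scale1r quot_scalerDr quot_scalerDl.

End QuotientModule.
End Submodules.

Arguments fullS {A} V.

(* The length of a module: the supremum, possibly +oo, of the lengths of the
   strictly increasing chains of submodules. *)
Definition module_length (K : realType) (A : comNzRingType) (V : lmodType A) : \bar K :=
  ereal_sup [set n%:R%:E | n in [set n : nat |
    exists c : nat -> submodClosed V,
      forall i, (i < n)%N -> properS (c i) (c i.+1)]].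

Section Ideals.
Variable A : comNzRingType.
Implicit Types I J P m : ideal A.

Definition noetherian : Prop := forall I, fgS I.

Definition maximal_ideal m : Prop :=
  1 \notin m /\ forall I, {subset m <= I} -> 1 \notin I -> I =i m.

Definition local_ring m : Prop :=
  maximal_ideal m /\ forall m', maximal_ideal m' -> m' =i m.

Definition primary_ideal I : Prop :=
  1 \notin I /\
  forall a b : A, a * b \in I -> a \in I \/ exists n : nat, b ^+ n \in I.

(* I is primary with radical m. *)
Definition is_primary_to m I : Prop :=
  primary_ideal I /\ forall a : A, a \in m <-> exists n : nat, a ^+ n \in I.

Definition prime_ideal P : Prop :=
  1 \notin P /\ forall a b : A, a * b \in P -> a \in P \/ b \in P.

Definition prime_chain (n : nat) : Prop :=
  exists c : nat -> ideal A,
    (forall i, (i <= n)%N -> prime_ideal (c i)) /\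
    (forall i, (i < n)%N -> properS (c i) (c i.+1)).

Definition has_krull_dim (d : nat) : Prop :=
  prime_chain d /\ forall n, prime_chain n -> (n <= d)%N.

(* 0 by convention if the Krull dimension is infinite, which does not happen
   for Noetherian local rings. *)
Definition krull_dim : nat := xget 0%N [set d | has_krull_dim d].

Fixpoint idealX I (n : nat) : ideal A :=
  if n is n'.+1 then scaleS I (idealX I n') else fullS A^o.

Definition frobenius_power J (q : nat) : ideal A :=
  spanS [set x : A^o | exists a : A, a \in J /\ x = a ^+ q].

(* I ^ ceil(s p^e) + J ^ [p^e] *)
Definition h_ideal (K : realType) (p : nat) (s : K) I J (e : nat) : ideal A :=
  addS (idealX I `|Num.ceil (s * (p ^ e)%:R)|%N) (frobenius_power J (p ^ e)).

Definition h_seq (K : realType) (p : nat) (s : K) I J (N : lmodType A)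
    (e : nat) : \bar K :=
  (module_length K (quotient_module (scaleS (h_ideal p s I J e) (fullS N)))
   * ((p ^ (e * krull_dim))%:R^-1)%:E)%E.

(* Meaningful when the limit exists. *)
Definition h_function (K : realType) (p : nat) (s : K) I J (N : lmodType A)
    : \bar K :=
  limn (h_seq p s I J N).

End Ideals.

Section Idealization.
Variables (R : comNzRingType) (M : lmodType R).

Definition idealization : Type := (R * M)%type.
HB.instance Definition _ := GRing.Zmodule.copy idealization (R * M)%type.

Definition idz_one : idealization := (1, 0).
Definition idz_mul (x y : idealization) : idealization :=
  (x.1 * y.1, x.1 *: y.2 + y.1 *: x.2).

Fact idz_mulA : associative idz_mul.
Proof.
move=> [a x] [b y] [c z]; congr pair; rewrite /= ?mulrA //.
by rewrite !scalerDr !scalerA addrA [c * a]mulrC [c * b]mulrC [b * c]mulrC.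
Qed.
Fact idz_mulC : commutative idz_mul.
Proof. by move=> [a x] [b y]; congr pair; rewrite /= ?[a * b]mulrC // addrC. Qed.
Fact idz_mul1 : left_id idz_one idz_mul.
Proof. by move=> [a x]; congr pair; rewrite /= ?mul1r // scale1r scaler0 addr0. Qed.
Fact idz_mulDl : left_distributive idz_mul +%R.
Proof.
move=> [a x] [b y] [c z]; congr pair; rewrite /= ?mulrDl //.
by rewrite scalerDl scalerDr addrACA.
Qed.
Fact idz_one_neq0 : idz_one != 0.
Proof. by apply/eqP => -[/eqP]; rewrite oner_eq0. Qed.

HB.instance Definition _ := GRing.Zmodule_isComNzRing.Build idealization
  idz_mulA idz_mulC idz_mul1 idz_mulDl idz_one_neq0.

(* R acts on R |x M through r |-> (r, 0). *)
Definition idz_scale (r : R) (x : idealization) : idealization :=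
  ((r, 0) : idealization) * x.

Fact idz_scaleA a b x : idz_scale a (idz_scale b x) = idz_scale (a * b) x.
Proof.
rewrite /idz_scale mulrA; congr (_ * _).
by congr pair; rewrite /= !scaler0 addr0.
Qed.
Fact idz_scale1 : left_id 1 idz_scale.
Proof. by move=> x; rewrite /idz_scale (mul1r x). Qed.
Fact idz_scaleDr : right_distributive idz_scale +%R.
Proof. by move=> a x y; rewrite /idz_scale mulrDr. Qed.
Fact idz_scaleDl x : {morph idz_scale^~ x : a b / a + b}.
Proof.
move=> a b; rewrite /idz_scale -mulrDl; congr (_ * _).
by congr pair; rewrite /= addr0.
Qed.

HB.instance Definition _ := GRing.Zmodule_isLmodule.Build R idealization
  idz_scaleA idz_scale1 idz_scaleDr idz_scaleDl.

(* I |x IM, both as an ideal of R |x M and as an R-submodule of R |x M. *)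
Definition idz_pred (I : ideal R) (x : idealization) : bool :=
  (x.1 \in I) && (x.2 \in scaleS I (fullS M)).

Fact idz_pred_ideal I :
  subsemimod_closed (idz_pred I : pred (idealization)^o).
Proof.
split; first split.
- by rewrite unfold_in /idz_pred (rpred0 I) rpred0.
- move=> x y /andP[x1 x2] /andP[y1 y2].
  by rewrite unfold_in /idz_pred (rpredD (S := I)) // rpredD.
- move=> [a u] [b v] /andP[/= bI vI]; rewrite unfold_in /idz_pred /=.
  rewrite (rpredZ (s := I) a) // rpredD //; first exact: rpredZ.
  by apply/asboolP => W; apply; exists b, u.
Qed.
HB.instance Definition _ I := GRing.isSubSemiModClosed.Build idealization
  (idealization)^o (idz_pred I : idealization^o -> bool) (idz_pred_ideal I).
Definition idz_ideal (I : ideal R) : ideal idealization :=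
  GRing.SubmodClosed.clone _ (idealization^o) (idz_pred I) _.

Definition idz_predR (I : ideal R) (x : idealization) : bool := idz_pred I x.
Fact idz_predR_submod I : subsemimod_closed (idz_predR I).
Proof.
have [[h0 hD] hZ] := idz_pred_ideal I.
by split=> [|r x xI]; [split | apply: (hZ (r, 0))].
Qed.
HB.instance Definition _ I := GRing.isSubSemiModClosed.Build R
  idealization (idz_predR I) (idz_predR_submod I).
Definition idz_submodule (I : ideal R) : submodClosed idealization :=
  GRing.SubmodClosed.clone _ _ (idz_predR I) _.

End Idealization.

(* Main.v *)
(** Write N = R |x M. Since J1 and J2 are generated by the pairs (a, 0) with a in
    I1, resp. I2, and (a, x)^q = (a^q, q a^(q-1) x) = (a^q, 0) for q = p^e > 1,
    the ideal J1^n + J2^[q] equals L = B |x BM with B = I1^n + I2^[q]. The exact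
    sequence 0 -> M/BM -> N/L -> R/B -> 0 is one of R-modules and of N-modules,
    where N acts on the outer terms through the surjection N -> R; so in both
    cases additivity gives length(N/L) = length(M/BM) + length(R/B). Every prime
    of N contains the square-zero ideal 0 |x M, so dim N = dim R, and it remains
    to divide by q^d and let e tend to infinity. *)
From HB Require Import structures.
Require Import Defs.
From mathcomp Require Import all_boot all_order all_algebra.
From mathcomp Require Import generic_quotient ring_quotient.
From mathcomp Require Import all_classical all_reals all_analysis.

From mathcomp Require Import zify.

Set Implicit Arguments.
Unset Strict Implicit.
Unset Printing Implicit Defensive.

Import Order.TTheory GRing.Theory Num.Theory.
Import numFieldNormedType.Exports.

Local Open Scope classical_set_scope.
Local Open Scope ring_scope.

(** * Submodules given by spans: equality, membership, induction *)

Lemma submod_eq {A : comNzRingType} {V : lmodType A} {U W : submodClosed V} :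
  U =i W -> U = W.
Proof.
case: U W => P cP [Q cQ] PQ.
have EPQ : P = Q by apply/funext => x; exact: PQ.
case: _ / EPQ cQ {PQ} => cQ; congr GRing.SubmodClosed.Pack.
(* Only the closure proofs can still differ, and these are propositions. *)
case: cP cQ => [[D0] [Z0]] [[D1] [Z1]].
by rewrite (Prop_irrelevance D0 D1) (Prop_irrelevance Z0 Z1).
Qed.

Section Spans.
Context {A : comNzRingType} {V : lmodType A}.
Implicit Types (S : set V) (U W : submodClosed V).

Definition submodule_set S : Prop :=
  [/\ S 0, forall x y, S x -> S y -> S (x + y) & forall a x, S x -> S (a *: x)].

Lemma mem_spanS S x : S x -> x \in spanS S.
Proof. by move=> Sx; apply/asboolP => W; apply. Qed.

Lemma spanS_sub S W : (forall x, S x -> x \in W) -> {subset spanS S <= W}.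
Proof. by move=> SW x /asboolP; apply. Qed.

(** A set closed under the module operations becomes a submodule once its membership is made
    boolean, so its span adds nothing. Images, preimages and contractions are introduced below as
    spans, and this lemma recovers their elements. *)
Lemma submodule_spanSP S x : submodule_set S -> x \in spanS S <-> S x.
Proof.
move=> [S0 SD SZ]; split; last exact: mem_spanS.
pose P (y : V) := `[< S y >].
have cP : GRing.subsemimod_closed P.
  split; first split.
  - exact/asboolP.
  - by move=> y z /asboolP Sy /asboolP Sz; apply/asboolP/SD.
  - by move=> a y /asboolP Sy; apply/asboolP/SZ.
pose W : submodClosed V := HB.pack P (GRing.isSubSemiModClosed.Build A V P cP).
move/(@spanS_sub S W) => h; apply/asboolP; apply: h => y Sy; exact/asboolP.
Qed.

Lemma spanS_ind S (P : set V) : submodule_set P -> S `<=` P ->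
  forall x, x \in spanS S -> P x.
Proof.
move=> cP SP x xS; apply/(submodule_spanSP _ cP).
by apply: spanS_sub x xS => y /SP; apply: mem_spanS.
Qed.

Lemma mem_addS {U W} x : x \in addS U W <-> exists u w, [/\ u \in U, w \in W & x = u + w].
Proof.
apply: submodule_spanSP; split.
- by exists 0, 0; rewrite !rpred0 addr0.
- move=> _ _ [u [w [uU wW ->]]] [u' [w' [uU' wW' ->]]].
  by exists (u + u'), (w + w'); rewrite !rpredD // addrACA.
- move=> a _ [u [w [uU wW ->]]].
  by exists (a *: u), (a *: w); rewrite !rpredZ // scalerDr.
Qed.

Lemma mem_scaleS (I : ideal A) U a x : a \in I -> x \in U -> a *: x \in scaleS I U.
Proof. by move=> aI xU; apply: mem_spanS; exists a, x. Qed.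

Lemma scaleS_sub (I : ideal A) U W :
  (forall a x, a \in I -> x \in U -> a *: x \in W) -> {subset scaleS I U <= W}.
Proof. by move=> h; apply: spanS_sub => _ [a [x [aI xU ->]]]; apply: h. Qed.

End Spans.

(** Needed because [h_seq] divides by B N even when N is the ring itself. *)
Lemma scaleS_regular_full {A : comNzRingType} (I : ideal A) :
  scaleS I (fullS A^o) = I.
Proof.
apply: submod_eq => x; apply/idP/idP.
  apply: scaleS_sub => a b aI _.
  by rewrite /GRing.scale /= mulrC; apply: (rpredZ (s := I) b).
by move=> xI; rewrite -[x]mulr1; apply: (mem_scaleS (U := fullS A^o)).
Qed.

(** * Lengths as suprema over chains of submodules *)

Section Lengths.
Context {A : comNzRingType} {V : lmodType A}.
Implicit Types (U W : submodClosed V) (c D : nat -> submodClosed V).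

(** These are the chains of V / U pulled back to V; the terms of [c] beyond index [n] are
    unconstrained. *)
Definition chain_over U c n : Prop :=
  (forall i, (i <= n)%N -> {subset U <= c i}) /\
  forall i, (i < n)%N -> properS (c i) (c i.+1).

(* The length of V / U, computed in the lattice of submodules of V. *)
Definition length_over (K : realType) U : \bar K :=
  ereal_sup [set n%:R%:E | n in [set n : nat | exists c, chain_over U c n]].

Lemma chain_over0 U : chain_over U (fun=> U) 0.
Proof. by split=> i; [move=> _ x | rewrite ltn0]. Qed.

Lemma length_over_ge0 (K : realType) U : (0 <= length_over K U)%E.
Proof.
by apply: ereal_sup_ubound; exists 0%N => //; exists (fun=> U); apply: chain_over0.
Qed.

Lemma properS_not U W : ~ properS U W -> {subset U <= W} -> {subset W <= U}.
Proof. by move=> nUW sUW; apply: contrapT => nWU; apply: nUW. Qed.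

(* Skipping the repetitions in a weakly increasing sequence. *)
Lemma strict_chain_of_weak U D n :
    (forall i, (i <= n)%N -> {subset U <= D i}) ->
    (forall i, (i < n)%N -> {subset D i <= D i.+1}) ->
  exists2 c, chain_over U c (\sum_(i < n) `[<properS (D i) (D i.+1)>])%N &
    c (\sum_(i < n) `[<properS (D i) (D i.+1)>])%N = D n.
Proof.
elim: n => [|n IHn] UD Dmono.
  by rewrite big_ord0; exists D => //; split.
have [||c [Uc cS] cn] := IHn.
- by move=> i /leqW; apply: UD.
- by move=> i /leqW; apply: Dmono.
rewrite big_ord_recr /=; set l := (\sum_(i < n) _)%N in Uc cS cn *.
(* A repetition leaves the chain as it is, since then [c l = D n = D n.+1]; a strict step appends
   [D n.+1] at index [l.+1]. *)
case: asboolP => [Dn|/properS_not/(_ (Dmono _ (leqnn _))) Dn]; last first.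
  rewrite addn0; exists c => //; rewrite cn; apply: submod_eq => x.
  by apply/idP/idP; [apply: Dmono | apply: Dn].
rewrite addn1; exists (fun i => if (i <= l)%N then c i else D n.+1); last by rewrite ltnn.
split=> i; first by case: (leqP i l) => [il _|_ _]; [apply: Uc | apply: UD].
rewrite ltnS => il; rewrite il; case: ltngtP il => // [il _|-> _].
  exact: cS.
by rewrite cn.
Qed.

End Lengths.

(** Meant for sets of chain lengths: concatenating chains puts every sum in [T], and splitting a
    chain bounds each member of [T] by a sum. The suprema may be infinite. *)
Lemma ereal_sup_nat_add (K : realType) (P Q T : set nat) :
    P 0%N -> Q 0%N -> (forall a b, P a -> Q b -> T (a + b)%N) ->
    (forall n, T n -> exists a b, [/\ P a, Q b & (n <= a + b)%N]) ->
  (ereal_sup [set n%:R%:E | n in T] : \bar K) =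
  (ereal_sup [set n%:R%:E | n in P] + ereal_sup [set n%:R%:E | n in Q])%E.
Proof.
pose sup (X : set nat) : \bar K := ereal_sup [set n%:R%:E | n in X].
move=> P0 Q0 PQT TPQ; rewrite -/(sup P) -/(sup Q) -/(sup T).
have le_sup (X : set nat) n : X n -> (n%:R%:E <= sup X)%E.
  by move=> Xn; apply: ereal_sup_ubound; exists n.
apply/eqP; rewrite eq_le; apply/andP; split.
  apply: ge_ereal_sup => _ [n /TPQ[a [b [Pa Qb nab]]] <-].
  apply: le_trans (leeD (le_sup _ _ Pa) (le_sup _ _ Qb)).
  by rewrite -EFinD lee_fin -natrD ler_nat.
have leQ a : P a -> (a%:R%:E + sup Q <= sup T)%E.
  move=> Pa; rewrite addeC -leeBrDr //; apply: ge_ereal_sup => _ [b Qb <-].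
  rewrite leeBrDr // addeC -EFinD -natrD; exact/le_sup/PQT.
(* A finite [sup Q] can be moved to the other side; an infinite one forces [sup T = +oo] through
   [leQ] at 0. *)
have [Qfin|] := boolP (sup Q \is a fin_num).
  rewrite -leeBrDr //; apply: ge_ereal_sup => _ [a Pa <-].
  by rewrite leeBrDr // leQ.
rewrite ge0_fin_numE ?(le_sup _ _ Q0)// -leNgt leye_eq => /eqP Qoo.
by have := leQ _ P0; rewrite {1}Qoo addey // leye_eq => /eqP->; exact: leey.
Qed.

(** * Submodules of V / U versus submodules of V above U *)

Section QuotientLength.
Context {A : comNzRingType} {V : lmodType A} (U : submodClosed V).
Local Notation Q := (quotient_module U).

Let pi (v : V) : Q := \pi_(Quotient.quot (zmodS U))%qT v.

Let piB : zmod_morphism pi.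
Proof. exact: (raddfB (\pi_(Quotient.quot (zmodS U))%qT)). Qed.
Let piZ a v : pi (a *: v) = a *: pi v. Proof. exact/esym/quot_scale_pi. Qed.
Let pi_surj w : exists v, pi v = w. Proof. by exists (repr w); apply: reprK. Qed.
Let pi_eq v v' : pi v = pi v' <-> v - v' \in U.
Proof.
split=> [|vU]; last by apply/eqP; rewrite -Quotient.idealrBE.
by move=> /eqP; rewrite -Quotient.idealrBE.
Qed.
Let pi0 v : v \in U -> pi v = 0.
Proof. by move=> vU; rewrite -(subrr (pi 0)) -piB; apply/pi_eq; rewrite subrr subr0. Qed.
Let piD v v' : pi (v + v') = pi v + pi v'.
Proof. by rewrite -{1}[v']opprK piB -[- v']sub0r piB (pi0 (rpred0 U)) sub0r opprK. Qed.

Let preim (X : submodClosed Q) : submodClosed V := spanS [set v | pi v \in X].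
Let img (X : submodClosed V) : submodClosed Q :=
  spanS [set w | exists2 v, v \in X & w = pi v].

Let preimP X v : v \in preim X <-> pi v \in X.
Proof.
apply: submodule_spanSP; split=> /= [|x y|a x].
- by rewrite pi0 rpred0.
- by rewrite piD; apply: rpredD.
- by rewrite piZ; apply: rpredZ.
Qed.

Let imgP X w : w \in img X <-> exists2 v, v \in X & w = pi v.
Proof.
apply: submodule_spanSP; split=> /=.
- by exists 0; rewrite ?pi0 ?rpred0.
- by move=> _ _ [x xX ->] [y yX ->]; exists (x + y); rewrite ?piD // rpredD.
- by move=> a _ [x xX ->]; exists (a *: x); rewrite ?piZ // rpredZ.
Qed.

(** Preimages along [pi] keep inclusions strict because [pi] is surjective; images do so because the
    terms of the chain contain U, the kernel of [pi]. *)
Lemma module_length_quot (K : realType) : module_length K Q = length_over K U.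
Proof.
congr ereal_sup; congr image; apply/funext => n; apply/propext; split=> -[c].
  move=> cS; exists (preim \o c); split=> i /=.
    by move=> _ v vU; apply/preimP; rewrite pi0 // rpred0.
  move=> /cS[sc nc]; split=> [v /preimP vc|h]; first exact/preimP/sc.
  apply: nc => w; have [v <-] := pi_surj w.
  by move=> /(preimP (c i.+1))/h/preimP.
move=> [Uc cS]; exists (img \o c) => i ilt /=; have [sc nc] := cS i ilt.
split=> [w /imgP[v vc ->]|h]; first by apply/imgP; exists v => //; apply: sc.
apply: nc => v vc; have /h/imgP[v' v'c /pi_eq vv'] : pi v \in img (c i.+1).
  by apply/imgP; exists v.
by rewrite -(subrK v' v) rpredD // Uc // ltnW.
Qed.

End QuotientLength.

(** * Additivity of length along a surjective change of rings *)

Section Additivity.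
(* Rings A and B may differ: V is the A-module in the middle, U and W are
   B-modules on which A acts through phi. *)
Context {A B : comNzRingType} {phi : A -> B}.
Context {U W : lmodType B} {V : lmodType A} {f : U -> V} {g : V -> W}.
Context {U0 : submodClosed U} {V0 : submodClosed V} {W0 : submodClosed W}.
(** Surjectivity makes preimages under [f] and images under [g] of A-submodules stable under B. *)
Hypothesis phi_surj : forall b, exists a, phi a = b.
Hypothesis fB : zmod_morphism f.
Hypothesis gB : zmod_morphism g.
Hypothesis fZ : forall a u, f (phi a *: u) = a *: f u.
Hypothesis gZ : forall a v, g (a *: v) = phi a *: g v.
Hypothesis g_surj : forall w, exists v, g v = w.
Hypothesis fg_exact : forall v, g v = 0 <-> exists u, f u = v.
(** [U0] is the preimage of [V0] and [W0] its image, so that 0 -> U/U0 -> V/V0 -> W/W0 -> 0 is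
    exact. *)
Hypothesis fV0 : forall u, f u \in V0 <-> u \in U0.
Hypothesis gV0 : forall w, w \in W0 <-> exists2 v, v \in V0 & g v = w.

Let f0 : f 0 = 0. Proof. by rewrite -(subrr 0) fB subrr. Qed.
Let g0 : g 0 = 0. Proof. by rewrite -(subrr 0) gB subrr. Qed.
Let fD x y : f (x + y) = f x + f y.
Proof. by rewrite -{1}[y]opprK fB -[- y]sub0r fB f0 sub0r opprK. Qed.
Let gD x y : g (x + y) = g x + g y.
Proof. by rewrite -{1}[y]opprK gB -[- y]sub0r gB g0 sub0r opprK. Qed.

Let f_preim (X : submodClosed V) : submodClosed U := spanS [set u | f u \in X].
Let g_preim (X : submodClosed W) : submodClosed V := spanS [set v | g v \in X].
(** Adding [V0] keeps the image above [V0], as a chain over [V0] requires. *)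
Let f_img (X : submodClosed U) : submodClosed V :=
  spanS [set v | exists u v0, [/\ u \in X, v0 \in V0 & v = f u + v0]].
Let g_img (X : submodClosed V) : submodClosed W :=
  spanS [set w | exists2 v, v \in X & w = g v].

Let f_preimP X u : u \in f_preim X <-> f u \in X.
Proof.
apply: submodule_spanSP; split=> /= [|x y|b x]; rewrite ?f0 ?rpred0 ?fD //.
- exact: rpredD.
- by have [a <-] := phi_surj b; rewrite fZ; apply: rpredZ.
Qed.

Let g_preimP X v : v \in g_preim X <-> g v \in X.
Proof.
apply: submodule_spanSP; split=> /= [|x y|b x]; rewrite ?g0 ?rpred0 ?gD //.
- exact: rpredD.
- by rewrite gZ; apply: rpredZ.
Qed.

Let f_imgP X v :
  v \in f_img X <-> exists u v0, [/\ u \in X, v0 \in V0 & v = f u + v0].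
Proof.
apply: submodule_spanSP; split=> /=.
- by exists 0, 0; rewrite !rpred0 f0 addr0.
- move=> _ _ [x [v0 [xX v0V ->]]] [y [w0 [yX w0V ->]]].
  by exists (x + y), (v0 + w0); rewrite !rpredD // fD addrACA.
- move=> a _ [x [v0 [xX v0V ->]]].
  by exists (phi a *: x), (a *: v0); rewrite !rpredZ // fZ scalerDr.
Qed.

Let g_imgP X w : w \in g_img X <-> exists2 v, v \in X & w = g v.
Proof.
apply: submodule_spanSP; split=> /=.
- by exists 0; rewrite ?g0 ?rpred0.
- move=> _ _ [x xX ->] [y yX ->].
  by exists (x + y); rewrite ?gD // rpredD.
- move=> b _ [x xX ->]; have [a <-] := phi_surj b.
  by exists (a *: x); rewrite ?gZ // rpredZ.
Qed.

(** If f u = f x + v0, then f (u - x) lies in [V0], hence u - x in [U0]. Thus [f_img] preserves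
    strict inclusions above [U0]. *)
Let f_img_preim (X : submodClosed U) u : {subset U0 <= X} -> f u \in f_img X -> u \in X.
Proof.
move=> U0X /f_imgP[x [v0 [xX v0V fu]]].
rewrite -(subrK x u) rpredD // U0X //; apply/fV0.
by rewrite fB fu addrAC subrr add0r.
Qed.

Lemma chain_over_cat cU cW a b : chain_over U0 cU a -> chain_over W0 cW b ->
  exists c, chain_over V0 c (a + b).
Proof.
move=> [U0c cUS] [W0c cWS].
(* At index [a] the term [g_preim (cW 0)] takes the place of [f_img (cU a)], which it contains. *)
exists (fun i => if (i < a)%N then f_img (cU i) else g_preim (cW (i - a)%N)).
split=> i.
  case: (ltnP i a) => [_ _ v vV0|ai iab v vV0].
    by apply/f_imgP; exists 0, v; rewrite f0 add0r rpred0.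
  by apply/g_preimP; apply: W0c; [rewrite leq_subLR | apply/gV0; exists v].
case: (ltnP i a) => [ia _|ai iab]; last first.
  rewrite [(i.+1 < a)%N]ltnNge (leqW ai) /= subSn //.
  have /cWS[sc nc] : (i - a < b)%N by rewrite ltn_subLR.
  split=> [v /g_preimP gv|h]; first by apply/g_preimP/sc.
  apply: nc => w; have [v <-] := g_surj w.
  by move=> /(g_preimP (cW (i - a).+1) v)/h/g_preimP.
have [sc nc] := cUS i ia.
have U0ci : {subset U0 <= cU i} by apply: U0c; apply: ltnW.
case: (ltnP i.+1 a) => [ia1|ai].
  split=> [v /f_imgP[u [v0 [uc v0V ->]]]|h].
    by apply/f_imgP; exists u, v0; rewrite sc.
  apply: nc => u uc; apply: f_img_preim => //; apply: h; apply/f_imgP.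
  by exists u, 0; rewrite rpred0 addr0.
(* Junction [i.+1 = a]: the image of [f] lies in every [g_preim], so strictness is inherited from
   [cU i] and [cU i.+1]. *)
have gf0 u : g (f u) = 0 by apply/fg_exact; exists u.
split=> [v /f_imgP[u [v0 [uc v0V ->]]]|h].
  apply/g_preimP; rewrite gD gf0 add0r; apply: W0c; first by lia.
  by apply/gV0; exists v0.
apply: nc => u uc; apply: f_img_preim => //; apply: h; apply/g_preimP.
by rewrite gf0 rpred0.
Qed.

(** Pull the chain back along [f], push it forward along [g], and drop repetitions: each strict step
    of [c] stays strict on at least one side. *)
Lemma chain_over_split c n : chain_over V0 c n ->
  exists a b cU cW,
    [/\ chain_over U0 cU a, chain_over W0 cW b & (n <= a + b)%N].
Proof.
move=> [V0c cS].
have [||cU cUa _] := @strict_chain_of_weak _ _ U0 (f_preim \o c) n.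
- move=> i /V0c V0ci u uU0; apply/f_preimP; apply: V0ci; exact/fV0.
- by move=> i /cS[sc _] u /f_preimP fu; apply/f_preimP; apply: sc.
have [||cW cWb _] := @strict_chain_of_weak _ _ W0 (g_img \o c) n.
- by move=> i /V0c V0ci w /gV0[v vV0 <-]; apply/g_imgP; exists v => //; apply: V0ci.
- by move=> i /cS[sc _] w /g_imgP[v vc ->]; apply/g_imgP; exists v => //; apply: sc.
eexists _, _, cU, cW; split; [exact: cUa | exact: cWb|].
(* Writing [n] as a sum of ones reduces the bound to one step of [c] at a time. *)
rewrite -big_split /= -[leqLHS]card_ord -sum1_card; apply: leq_sum => i _.
have [sc nc] := cS i (ltn_ord i).
case: asboolP => // /properS_not nU; case: asboolP => // /properS_not nW.
case: nc => v vc.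
(* If neither side grows, an element [v] of [c i.+1] agrees under [g] with some [v'] of [c i]; then
   [v - v'] is some [f u] in [c i.+1], hence in [c i], and so is [v]. *)
have /g_imgP[v' v'c gv] : g v \in g_img (c i).
  apply: nW; last by apply/g_imgP; exists v.
  by move=> w /g_imgP[x xc ->]; apply/g_imgP; exists x => //; apply: sc.
have [u fu] : exists u, f u = v - v' by apply/fg_exact; rewrite gB gv subrr.
rewrite -(subrK v' v) rpredD // -fu; apply/f_preimP; apply: nU.
  by move=> x /f_preimP xc; apply/f_preimP; apply: sc.
by apply/f_preimP; rewrite fu -scaleN1r rpredD ?rpredZ // sc.
Qed.

Lemma length_over_exact (K : realType) :
  length_over K V0 = (length_over K U0 + length_over K W0)%E.
Proof.
apply: ereal_sup_nat_add.
- by exists (fun=> U0); apply: chain_over0.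
- by exists (fun=> W0); apply: chain_over0.
- by move=> a b [cU cUa] [cW cWb]; apply: chain_over_cat cUa cWb.
- move=> n [c /chain_over_split[a [b [cU [cW [cUa cWb nab]]]]]].
  by exists a, b; split => //; [exists cU | exists cW].
Qed.

End Additivity.

(** * Sums, products, powers and Frobenius powers of ideals I |x IM *)

Lemma ideal_mul (A : comNzRingType) (I : ideal A) (a x : A) : x \in I -> a * x \in I.
Proof. exact: (rpredZ (s := I)). Qed.

Lemma addS_sub (A : comNzRingType) (V : lmodType A) (U W X : submodClosed V) :
  {subset U <= X} -> {subset W <= X} -> {subset addS U W <= X}.
Proof. by move=> UX WX x /mem_addS[u [w [/UX uX /WX wX ->]]]; apply: rpredD. Qed.

Lemma addS_subl (A : comNzRingType) (V : lmodType A) (U W : submodClosed V) :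
  {subset U <= addS U W}.
Proof. by move=> u uU; apply/mem_addS; exists u, 0; rewrite rpred0 addr0. Qed.

Lemma addS_subr (A : comNzRingType) (V : lmodType A) (U W : submodClosed V) :
  {subset W <= addS U W}.
Proof. by move=> w wW; apply/mem_addS; exists 0, w; rewrite rpred0 add0r. Qed.

Section IdealizationIdeals.
Context {R : comNzRingType} {M : lmodType R}.
Implicit Types (I J : ideal R) (L : ideal (idealization M)).
Local Notation RM := (idealization M).

Lemma idz_mulE (x y : RM) : x * y = (x.1 * y.1, x.1 *: y.2 + y.1 *: x.2) :> RM.
Proof. by []. Qed.

Lemma mem_idz_ideal I (x : RM) :
  (x \in idz_ideal M I) = (x.1 \in I) && (x.2 \in scaleS I (fullS M)).
Proof. by []. Qed.

Lemma idz_ideal_mono I J : {subset I <= J} -> {subset idz_ideal M I <= idz_ideal M J}.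
Proof.
move=> IJ x; rewrite !mem_idz_ideal => /andP[/IJ-> x2] /=.
by move: x.2 x2; apply: scaleS_sub => a y /IJ aJ yM; apply: mem_scaleS.
Qed.

Lemma idz_inl_mul L (a : R) (y : M) : ((a, 0) : RM) \in L -> ((0, a *: y) : RM) \in L.
Proof.
move=> aL; have -> : ((0, a *: y) : RM) = ((0, y) : RM) * (a, 0).
  by rewrite idz_mulE /= mul0r scale0r add0r.
exact: ideal_mul.
Qed.

(* I |x IM is the ideal generated by the pairs (a, 0) with a in I. *)
Lemma idz_ideal_sub I L :
  (forall a, a \in I -> ((a, 0) : RM) \in L) -> {subset idz_ideal M I <= L}.
Proof.
move=> IL [a y] /andP[/= aI yIM].
have -> : ((a, y) : RM) = ((a, 0) : RM) + (0, y) by congr pair; rewrite /= ?addr0 ?add0r.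
rewrite (rpredD (S := L)) ?IL //.
move: y yIM; apply: spanS_ind; first split=> /=.
- exact: (rpred0 L).
- move=> x y xL yL; have -> : ((0, x + y) : RM) = ((0, x) : RM) + (0, y).
    by congr pair; rewrite addr0.
  exact: (rpredD (S := L)).
- move=> b x xL; have -> : ((0, b *: x) : RM) = ((b, 0) : RM) * (0, x).
    by rewrite idz_mulE /= mulr0 scaler0 addr0.
  exact: ideal_mul.
- by move=> _ [b [x [bI _ ->]]]; apply/idz_inl_mul/IL.
Qed.

(** The elements a with (a, 0) in [L] form an ideal of R, so generators suffice. This settles the
    harder inclusion for sums, products and Frobenius powers. *)
Lemma idz_ideal_span_sub (S : set R^o) L :
  (forall a, S a -> ((a, 0) : RM) \in L) -> {subset idz_ideal M (spanS S) <= L}.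
Proof.
move=> SL; apply: idz_ideal_sub; apply: spanS_ind => //; split=> /=.
- exact: (rpred0 L).
- move=> x y xL yL; have -> : ((x + y, 0) : RM) = ((x, 0) : RM) + (y, 0).
    by congr pair; rewrite addr0.
  exact: (rpredD (S := L)).
- move=> b x xL; have -> : ((b *: x, 0) : RM) = ((b, 0) : RM) * (x, 0).
    by rewrite idz_mulE /= !scaler0 addr0.
  exact: ideal_mul.
Qed.

Lemma mem_idz_inl I (a : R) : a \in I -> ((a, 0) : RM) \in idz_ideal M I.
Proof. by move=> aI; rewrite mem_idz_ideal aI /= rpred0. Qed.

Lemma idz_ideal_add I J :
  addS (idz_ideal M I) (idz_ideal M J) = idz_ideal M (addS I J).
Proof.
apply: submod_eq => x; apply/idP/idP.
  by apply: addS_sub; apply: idz_ideal_mono; [apply: addS_subl | apply: addS_subr].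
apply: idz_ideal_span_sub => _ [a [b [aI bJ ->]]].
have -> : ((a + b, 0) : RM) = ((a, 0) : RM) + (b, 0) by congr pair; rewrite addr0.
by apply/mem_addS; exists (a, 0), (b, 0); rewrite !mem_idz_inl.
Qed.

(** In (a, x)(b, y) = (ab, ay + bx) both ay and bx lie in IJM; conversely (ab, 0) = (a, 0)(b, 0). *)
Lemma idz_ideal_scale I J :
  scaleS (idz_ideal M I) (idz_ideal M J) = idz_ideal M (scaleS I J).
Proof.
apply: submod_eq => x; apply/idP/idP.
  move: x; apply: scaleS_sub => -[a x] [b y]; rewrite !mem_idz_ideal /=.
  move=> /andP[aI xIM] /andP[bJ yJM]; rewrite (mem_scaleS (U := J)) //= rpredD //.
    move: y yJM; apply: spanS_ind; first split=> /=.
    - by rewrite scaler0 rpred0.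
    - by move=> z t; rewrite scalerDr; apply: rpredD.
    - by move=> c z az; rewrite scalerA mulrC -scalerA rpredZ.
    move=> _ [c [z [cJ _ ->]]]; rewrite /= scalerA.
    by apply: mem_scaleS => //; apply: (mem_scaleS (U := J)).
  move: x xIM; apply: spanS_ind; first split=> /=.
  - by rewrite scaler0 rpred0.
  - by move=> z t; rewrite scalerDr; apply: rpredD.
  - by move=> c z az; rewrite scalerA mulrC -scalerA rpredZ.
  move=> _ [c [z [cI _ ->]]]; rewrite /= scalerA mulrC.
  by apply: mem_scaleS => //; apply: (mem_scaleS (U := J)).
move: x; apply: idz_ideal_span_sub => _ [a [b [aI bJ ->]]].
have -> : ((a *: b, 0) : RM) = ((a, 0) : RM) *: ((b, 0) : RM^o).
  by rewrite [RHS]idz_mulE /= !scaler0 addr0.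
by apply: mem_scaleS; apply: mem_idz_inl.
Qed.

Lemma idz_ideal_full : idz_ideal M (fullS R^o) = fullS RM^o.
Proof.
apply: submod_eq => -[a x]; transitivity true; last by [].
rewrite mem_idz_ideal; apply/andP; split=> //=.
by rewrite -[x]scale1r; apply: mem_scaleS.
Qed.

Lemma idz_idealX I n : idealX (idz_ideal M I) n = idz_ideal M (idealX I n).
Proof. by elim: n => [|n /= ->]; rewrite ?idz_ideal_full ?idz_ideal_scale. Qed.

(** The binomial expansion of (a, 0) + (0, x) stops after the linear term, as (0, x) squares to
    zero. *)
Lemma idz_exp (a : R) (x : M) n :
  ((a, x) : RM) ^+ n.+1 = (a ^+ n.+1, (a ^+ n *+ n.+1) *: x).
Proof.
elim: n => [|n IHn]; first by rewrite !expr1 expr0 scale1r.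
rewrite exprS IHn idz_mulE /= -exprS; congr pair.
by rewrite scalerA -scalerDl mulrnAr -exprS -mulrSr.
Qed.

Lemma idz_frobenius_power I p e : p \in [pchar R] ->
  frobenius_power (idz_ideal M I) (p ^ e) = idz_ideal M (frobenius_power I (p ^ e)).
Proof.
move=> pR; apply: submod_eq => x; apply/idP/idP; move: x.
  apply: spanS_sub => _ [[a x] [aI ->]]; move: aI.
  rewrite mem_idz_ideal => /andP[/= aI xI].
  (* For q = 1 the second component survives, but it stays in place because the first Frobenius
     power of I contains I. *)
  case: e => [|e].
    rewrite expn0 expr1 mem_idz_ideal /=; apply/andP; split.
      by apply: mem_spanS; exists a.
    move: x xI; apply: scaleS_sub => b y bI _; apply: mem_scaleS => //.
    by apply: mem_spanS; exists b.
  have q_gt0 : (0 < p ^ e.+1)%N by rewrite expn_gt0 prime_gt0 // (pcharf_prime pR).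
  (* The coefficient q of the second component is a positive power of p, hence zero in R. *)
  rewrite -(prednK q_gt0) idz_exp prednK // -mulr_natr natrX (pcharf0 pR)
    expr0n mulr0 scale0r.
  by apply: mem_idz_inl; apply: mem_spanS; exists a.
apply: idz_ideal_span_sub => _ [a [aI ->]]; apply: mem_spanS.
exists (a, 0); split; first exact: mem_idz_inl.
have q_gt0 : (0 < p ^ e)%N by rewrite expn_gt0 prime_gt0 // (pcharf_prime pR).
by rewrite -(prednK q_gt0) idz_exp scaler0.
Qed.

Lemma h_ideal_idz (K : realType) p (s : K) I J e : p \in [pchar R] ->
  h_ideal p s (idz_ideal M I) (idz_ideal M J) e = idz_ideal M (h_ideal p s I J e).
Proof.
by move=> pR; rewrite /h_ideal idz_idealX idz_frobenius_power // idz_ideal_add.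
Qed.

End IdealizationIdeals.

(** * Length of (R |x M) / (I |x IM) over both rings *)

Section IdealizationLength.
Context {R : comNzRingType} {M : lmodType R} (K : realType) (I : ideal R).
Local Notation RM := (idealization M).

Let inr_idz (x : M) : RM := (0, x).
Let fst_idz (x : RM) : R^o := x.1.

Let inrB : zmod_morphism inr_idz.
Proof. by move=> x y; congr pair; rewrite subr0. Qed.

Let fst_exact v : fst_idz v = 0 <-> exists u, inr_idz u = v.
Proof. by case: v => a x; split=> [/= ->|[u [<- _]]]; first by exists x. Qed.

(** Here R |x M acts on M and on R through the first projection, which serves as [phi]. *)
Lemma length_over_idz_ideal :
  length_over K (idz_ideal M I) =
  (length_over K (scaleS I (fullS M)) + length_over K I)%E.
Proof.
apply: (@length_over_exact RM R fst M R^o RM^o inr_idz fst_idz) => //.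
- by move=> b; exists (b, 0).
- by move=> [a y] u; rewrite [RHS]idz_mulE /= mulr0 scale0r addr0.
- by move=> w; exists (w, 0).
- by move=> u; rewrite mem_idz_ideal /inr_idz /= (rpred0 I).
- move=> w; split=> [wI|[v vI <-]]; first by exists (w, 0) => //; apply: mem_idz_inl.
  by move: vI; rewrite mem_idz_ideal => /andP[].
Qed.

(** The same maps are R-linear, so [phi] is now the identity and the length does not change. *)
Lemma length_over_idz_submodule :
  length_over K (idz_submodule M I) =
  (length_over K (scaleS I (fullS M)) + length_over K I)%E.
Proof.
apply: (@length_over_exact R R id M R^o RM inr_idz fst_idz) => //.
- by move=> b; exists b.
- by move=> a u; rewrite [RHS]idz_mulE /= mulr0 scale0r addr0.
- by move=> w; exists (w, 0).
- by move=> u; rewrite [_ \in idz_submodule _ _]mem_idz_ideal /inr_idz /= (rpred0 I).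
- move=> w; split=> [wI|[v vI <-]]; first by exists (w, 0) => //; apply: mem_idz_inl.
  by move: vI; rewrite [_ \in _]mem_idz_ideal => /andP[].
Qed.

End IdealizationLength.

(** * Prime chains and Krull dimension of R |x M *)

Section IdealizationDimension.
Context {R : comNzRingType} {M : lmodType R}.
Local Notation RM := (idealization M).

Lemma prime_idz_inr (P : ideal RM) (x : M) : prime_ideal P -> ((0, x) : RM) \in P.
Proof.
move=> [_ PM]; have h : ((0, x) : RM) * (0, x) \in P.
  by rewrite idz_mulE /= mul0r scale0r addr0 (rpred0 P).
by case: (PM _ _ h).
Qed.

(** (a, x) and (a, 0) differ by an element of 0 |x M, which every prime contains. *)
Lemma prime_idz (P : ideal RM) (x : RM) : prime_ideal P ->
  x \in P <-> ((x.1, 0) : RM) \in P.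
Proof.
move=> Pp; case: x => a x /=.
have aE : ((a, x) : RM) = ((a, 0) : RM) + (0, x) by congr pair; rewrite /= ?addr0 ?add0r.
have aE' : ((a, 0) : RM) = ((a, x) : RM) + (0, - x)
  by congr pair; rewrite /= ?addr0 ?subrr.
by split=> aP; [rewrite aE' | rewrite aE]; apply: (rpredD (S := P)) => //;
  apply: prime_idz_inr.
Qed.

(** [up P] is P |x M, the preimage under the projection to R; [down] is contraction along r |-> (r,
    0). *)
Let up (P : ideal R) : ideal RM := spanS [set x : RM^o | x.1 \in P].
Let down (P : ideal RM) : ideal R := spanS [set a : R^o | ((a, 0) : RM) \in P].

Let upP P (x : RM) : x \in up P <-> x.1 \in P.
Proof.
apply: (submodule_spanSP (S := [set x : RM^o | x.1 \in P])); split=> /=.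
- exact: (rpred0 P).
- by move=> y z; apply: (rpredD (S := P)).
- by move=> a y; apply: ideal_mul.
Qed.

Let downP P (a : R) : a \in down P <-> ((a, 0) : RM) \in P.
Proof.
apply: (submodule_spanSP (S := [set a : R^o | ((a, 0) : RM) \in P])); split=> /=.
- exact: (rpred0 P).
- move=> x y xL yL; have -> : ((x + y, 0) : RM) = ((x, 0) : RM) + (y, 0).
    by congr pair; rewrite addr0.
  exact: (rpredD (S := P)).
- move=> b x xL; have -> : ((b *: x, 0) : RM) = ((b, 0) : RM) * (x, 0).
    by rewrite idz_mulE /= !scaler0 addr0.
  exact: ideal_mul.
Qed.

Lemma prime_chain_idz n : prime_chain RM n <-> prime_chain R n.
Proof.
split=> -[c [cP cS]].
  exists (down \o c); split=> i /=; [move=> /cP [c1 cM]|move=> ilt].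
    split=> [|a b /downP abc]; first by apply/negP => /downP; apply/negP.
    have : ((a, 0) : RM) * (b, 0) \in c i by rewrite idz_mulE /= !scaler0 addr0.
    by move=> /cM[ac|bc]; [left|right]; apply/downP.
  have [sc nc] := cS i ilt; split=> [a /downP ac|h]; first by apply/downP/sc.
  (* Contraction keeps inclusions of primes strict, since a prime is determined by its elements (a,
     0). *)
  apply: nc => x /(prime_idz _ (cP _ ilt))/downP/h/downP xc.
  by apply/(prime_idz _ (cP _ (ltnW ilt))).
exists (up \o c); split=> i /=; [move=> /cP [c1 cM]|move=> ilt].
  split=> [|x y /upP/cM[xc|yc]]; first by apply/negP => /upP; apply/negP.
    by left; apply/upP.
  by right; apply/upP.
have [sc nc] := cS i ilt; split=> [a /upP ac|h]; first by apply/upP/sc.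
apply: nc => a ac; have /h/upP : ((a, 0) : RM) \in up (c i.+1) by apply/upP.
by [].
Qed.

Lemma krull_dim_eq (A : comNzRingType) d : has_krull_dim A d -> krull_dim A = d.
Proof.
move=> [dA dmax]; apply: xget_unique => // n [nA nmax].
by apply/eqP; rewrite eqn_leq dmax // nmax.
Qed.

Lemma has_krull_dim_idz d : has_krull_dim R d -> has_krull_dim RM d.
Proof.
move=> [dR dmax]; split; first exact/prime_chain_idz.
by move=> n /prime_chain_idz; apply: dmax.
Qed.

End IdealizationDimension.

(** * Termwise identity and passage to the limit *)

Theorem theorem4p2 (K : realType) (R : comNzRingType) (m : ideal R)
    (M : lmodType R) (p d : nat) (s : K) (I1 I2 : ideal R)
    (R_noetherian : noetherian R)
    (R_local : local_ring m)
    (R_char : p \in [pchar R])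
    (R_dim : has_krull_dim R d)
    (d_gt0 : (0 < d)%N)
    (M_fg : fg_module M)
    (s_gt0 : 0 < s)
    (I1_primary : is_primary_to m I1)
    (I2_primary : is_primary_to m I2)
    (h_exists_R : cvgn (h_seq p s I1 I2 R^o))
    (h_exists_M : cvgn (h_seq p s I1 I2 M)) :
  let RM := idealization M in
  let J1 := idz_ideal M I1 in
  let J2 := idz_ideal M I2 in
  let u := fun e : nat =>
    (module_length K (quotient_module (idz_submodule M (h_ideal p s I1 I2 e)))
     * ((p ^ (e * d))%:R^-1)%:E)%E in
  [/\ cvgn (h_seq p s J1 J2 RM^o), cvgn u,
      h_function p s J1 J2 RM^o
        = (h_function p s I1 I2 R^o + h_function p s I1 I2 M)%E &
      (h_function p s I1 I2 R^o + h_function p s I1 I2 M)%E = limn u].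
Proof.
move=> RM J1 J2 u; rewrite /h_function.
(* Nonnegativity will exclude oo - oo when the two limits are added. *)
have h_seq_ge0 (N : lmodType R) e : (0 <= h_seq p s I1 I2 N e)%E.
  by rewrite mule_ge0 ?module_length_quot ?length_over_ge0 // lee_fin invr_ge0.
(* Common value of the e-th terms of both sequences; the factor distributes because lengths are
   nonnegative. *)
have sumE e : ((length_over K (scaleS (h_ideal p s I1 I2 e) (fullS M)) +
    length_over K (h_ideal p s I1 I2 e)) * ((p ^ (e * d))%:R^-1)%:E =
    h_seq p s I1 I2 R^o e + h_seq p s I1 I2 M e)%E.
  rewrite /h_seq !module_length_quot scaleS_regular_full (krull_dim_eq R_dim).
  by rewrite addeC ge0_muleDl ?length_over_ge0.
have -> : u = (fun e => h_seq p s I1 I2 R^o e + h_seq p s I1 I2 M e)%E.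
  apply/funext => e; rewrite -sumE /u module_length_quot.
  by rewrite length_over_idz_submodule.
have -> : h_seq p s J1 J2 RM^o =
    (fun e => h_seq p s I1 I2 R^o e + h_seq p s I1 I2 M e)%E.
  apply/funext => e; rewrite -sumE /h_seq module_length_quot scaleS_regular_full.
  rewrite h_ideal_idz // length_over_idz_ideal.
  by rewrite (krull_dim_eq (has_krull_dim_idz R_dim)).
have lim_def : (limn (h_seq p s I1 I2 R^o) +? limn (h_seq p s I1 I2 M))%E.
  by apply: ge0_adde_def; rewrite inE; apply: lime_ge => //; apply: nearW.
have cvD := is_cvgeD lim_def h_exists_R h_exists_M.
have limD := limeD h_exists_R h_exists_M lim_def.
by split; [exact: cvD | exact: cvD | exact: limD | symmetry; exact: limD].
Qed.
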